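(* Let $d$ be an odd prime. For each vector $\vec c=(c_0,c_1,\dots,c_{d-1})$ of complex numbers of modulus one with $c_0=1$, let $U(\vec c)$ be the one-qudit unitary $U(\vec c)=F\,\mathrm{diag}(c_0,\dots,c_{d-1})$, i.e. $U(\vec c)|j\rangle=c_j\frac{1}{\sqrt d}\sum_{m\in\mathbb{Z}_d}\omega^{jm}|m\rangle$. Then every unitary $V\in U(d)$ can be written as a finite product of gates of the form $U(\vec c)$.
   Context: $\omega=e^{2\pi i/d}$; qudits have computational basis $\{|j\rangle : j\in\mathbb{Z}_d\}$; $F|j\rangle=\frac1{\sqrt d}\sum_{m\in\mathbb{Z}_d}\omega^{jm}|m\rangle$ is the quantum Fourier transform on one qudit. *)

(* Defs.v *)
(* complex numbers are R[i] over Stdlib's reals R (a realType via Rstruct). *)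
From HB Require Import structures.
From mathcomp Require Import all_boot all_order all_algebra.
From mathcomp Require Import complex.
From mathcomp Require Import reals Rstruct trigo.
Set Implicit Arguments. Unset Strict Implicit. Unset Printing Implicit Defensive.
Import Order.TTheory GRing.Theory Num.Theory.
Local Open Scope ring_scope.
Local Open Scope complex_scope.

(* The field of complex numbers. *)
Definition C : Type := (Rdefinitions.R)[i].

(* omega = e^{2 pi i / d} = cos(2pi/d) + i sin(2pi/d). *)
Definition omega (d : nat) : C :=
  (cos (2 * pi / d%:R) +i* sin (2 * pi / d%:R))%C.

(* Quantum Fourier transform on one qudit: column j is F|j>, so F m j = omega^(jm)/sqrt d. *)
Definition QFT (d : nat) : 'M[C]_d :=
  \matrix_(m < d, j < d) ((omega d) ^+ (j * m) / ((Num.sqrt (d%:R : Rdefinitions.R))%:C)%C).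

(* U(c) = F diag(c_0,...,c_{d-1}). *)
Definition Ugate (d : nat) (c : 'rV[C]_d) : 'M[C]_d := QFT d *m diag_mx c.

(* Admissible parameter vectors: all entries of modulus one, c_0 = 1. *)
Definition admissible (d : nat) (c : 'rV[C]_d) : Prop :=
  (forall j : 'I_d, `|c 0 j| = 1) /\ (forall j : 'I_d, nat_of_ord j = 0%N -> c 0 j = 1).

(* Unitary d x d matrices: V V^dagger = 1. *)
Definition unitary_mx (d : nat) (V : 'M[C]_d) : Prop :=
  V *m (map_mx (fun z : C => z^*) V)^T = 1%:M.

(* Ordered product of a finite list of gates: [U1; U2; ...; Uk] |-> U1 * U2 * ... * Uk. *)
Definition gate_product (d : nat) (s : seq 'rV[C]_d) : 'M[C]_d :=
  foldr (fun c M => Ugate c *m M) 1%:M s.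

(* Main.v *)
(* Let G be the set of products of gates, and call a nonzero vector u a reflection vector when
   every complex reflection 1 + (z - 1) u u^* / (u^* u), |z| = 1, lies in G.  If u and v are
   reflection vectors, so is the image of v under any reflection along u.  Starting from a
   single reflection vector u not orthogonal to a basis vector e_k that is also one, this
   yields every nonzero vector obtained from u by changing its k-th coordinate.

   Since F^4 = 1, the adjoint of F is F^3, so G contains diag(c) and F diag(c) F^* for every
   admissible c.  Hence e_k (k <> 0) and column 1 of F, which has no zero entry, are reflection
   vectors.  Zeroing the coordinates k <> 0 of that column makes e_0 a reflection vector, and
   then changing all its coordinates one at a time reaches every nonzero vector.  By the
   spectral theorem every unitary matrix is a product of complex reflections. *)
Require Import Defs.
From mathcomp Require Import all_boot all_order all_algebra spectral.
From mathcomp Require Import ring lra complex reals Rstruct trigo.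
Set Implicit Arguments. Unset Strict Implicit. Unset Printing Implicit Defensive.
Import Order.TTheory GRing.Theory Num.Theory.
Local Open Scope ring_scope.
Local Open Scope sesquilinear_scope.

(** * Complex reflections *)

Section Reflections.
Variables (K : numClosedFieldType) (n : nat).
Implicit Types (u v w : 'cV[K]_n) (M : 'M[K]_n) (a z : K).

Definition inner u v : K := (u ^t* *m v) 0 0.

Definition reflection u z : 'M[K]_n :=
  1%:M + ((z - 1) / inner u u) *: (u *m u ^t*).

Lemma innerE u v : inner u v = \sum_i (u i 0)^* * v i 0.
Proof. by rewrite /inner mxE; apply: eq_bigr => i _; rewrite !mxE. Qed.

Lemma innerDr u v w : inner u (v + w) = inner u v + inner u w.
Proof. by rewrite /inner mulmxDr mxE. Qed.

Lemma innerZr a u v : inner u (a *: v) = a * inner u v.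
Proof. by rewrite /inner -scalemxAr mxE. Qed.

Lemma innerC u v : inner v u = (inner u v)^*.
Proof.
rewrite !innerE rmorph_sum; apply: eq_bigr => i _.
by rewrite /= rmorphM /= conjCK mulrC.
Qed.

Lemma innerDl u v w : inner (u + v) w = inner u w + inner v w.
Proof. by rewrite innerC innerDr rmorphD /= -!innerC. Qed.

Lemma innerZl a u v : inner (a *: u) v = a^* * inner u v.
Proof. by rewrite innerC innerZr rmorphM /= -innerC. Qed.

Lemma inner_ge0 u : 0 <= inner u u.
Proof.
by rewrite innerE sumr_ge0 // => i _; rewrite mulrC mul_conjC_ge0.
Qed.

Lemma inner_eq0 u : (inner u u == 0) = (u == 0).
Proof.
apply/idP/eqP => [|->]; last by rewrite innerE big1 // => i _; rewrite mxE mulr0.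
rewrite innerE psumr_eq0 => [/allP u0|i _]; last by rewrite mulrC mul_conjC_ge0.
apply/colP => i; have := u0 i (mem_index_enum _).
by rewrite mulrC mul_conjC_eq0 mxE => /eqP.
Qed.

Lemma reflection_mul u z v :
  reflection u z *m v = v + ((z - 1) / inner u u * inner u v) *: u.
Proof.
rewrite mulmxDl mul1mx -scalemxAl -mulmxA [u ^t* *m v]mx11_scalar mul_mx_scalar.
by rewrite scalerA.
Qed.

(** Scaling [u] by [a] multiplies both [u *m u ^t*] and [inner u u] by |a|^2, so only the line
    through [u] matters. *)
Lemma reflectionZ a u z : a != 0 -> reflection (a *: u) z = reflection u z.
Proof.
move=> a0; have [->|u0] := eqVneq u 0; first by rewrite scaler0.
rewrite /reflection innerZl innerZr; congr (_ + _).
have -> : (a *: u) ^t* = a^* *: u ^t*.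
  by apply/matrixP => i j; rewrite !mxE rmorphM.
rewrite -scalemxAl -scalemxAr !scalerA; congr (_ *: _).
have := inner_eq0 u; rewrite (negPf u0) => /negbT i0.
have ac0 : a^* != 0 by rewrite conjC_eq0.
by field; rewrite i0 a0 ac0.
Qed.

Lemma conj_reflection M u z : M \is unitarymx ->
  M *m reflection u z *m M ^t* = reflection (M *m u) z.
Proof.
move=> Mu; have MM : M ^t* *m M = 1%:M.
  by apply: mulmx1C; apply/unitarymxP.
rewrite /reflection mulmxDr mulmxDl mulmx1 (unitarymxP Mu).
have -> : (M *m u) ^t* = u ^t* *m M ^t*.
  by rewrite trmx_mul map_mxM.
rewrite -scalemxAr -scalemxAl !mulmxA; congr (_ + (_ / _) *: _).
by rewrite /inner trmx_mul map_mxM !mulmxA -(mulmxA (u ^t*)) MM mulmx1.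
Qed.

Lemma inner_delta k v : inner (delta_mx k 0) v = v k 0.
Proof.
rewrite innerE (bigD1 k) //= big1 => [|i /negPf ik]; last by rewrite !mxE ik conjC0 mul0r.
by rewrite !mxE eqxx conjC1 mul1r addr0.
Qed.

Lemma reflection_delta k z :
  reflection (delta_mx k 0) z = diag_mx (\row_j if j == k then z else 1).
Proof.
have dadj : (delta_mx k 0 : 'cV[K]_n) ^t* = delta_mx 0 k.
  by rewrite trmx_delta map_delta_mx.
rewrite /reflection dadj mul_delta_mx.
have -> : inner (delta_mx k 0) (delta_mx k 0) = 1 by rewrite inner_delta mxE !eqxx.
apply/matrixP => i j; rewrite !mxE divr1.
have [<-|ij] := eqVneq i j; last first.
  by case: eqVneq => [ik|//]; rewrite ?mulr0n ?mulr0 ?addr0 //= -ik eq_sym (negPf ij) mulr0 addr0.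
by case: eqVneq => //= _; rewrite ?mulr1n ?mulr1 ?mulr0 ?addr0 // addrC subrK.
Qed.

(** The diagonal matrix is the reflection along a basis vector, and conjugation by a unitary matrix
    moves the axis of a reflection. *)
Lemma conj_diag (P : 'M[K]_n) k z : P \is unitarymx ->
  P *m diag_mx (\row_j if j == k then z else 1) *m P ^t* = reflection (col k P) z.
Proof. by move=> Pu; rewrite -reflection_delta conj_reflection // colE. Qed.

Lemma reflection_adj u z : (reflection u z) ^t* = reflection u z^*.
Proof.
apply/matrixP => i j; rewrite !mxE !big_ord1 !mxE rmorphD /= conjC_nat eq_sym.
congr (_ + _); rewrite !rmorphM /= fmorphV rmorphB /= conjC1 conjCK -innerC.
by rewrite -!mulrA [_^* * _]mulrC.
Qed.

Lemma reflection_unitary u z : u != 0 -> `|z| = 1 -> reflection u z \is unitarymx.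
Proof.
move=> u0 z1; have i0 : inner u u != 0 by rewrite inner_eq0.
have zz : z * z^* = 1 by rewrite -normCK z1 expr1n.
apply/unitarymxP; rewrite reflection_adj /reflection mulmxDl mul1mx mulmxDr mulmx1.
rewrite -[RHS]addr0 -addrA; congr (_ + _).
rewrite -scalemxAl -scalemxAr scalerA.
have -> : u *m u ^t* *m (u *m u ^t*) = inner u u *: (u *m u ^t*).
  by rewrite mulmxA -(mulmxA u) [u ^t* *m u]mx11_scalar mul_mx_scalar -scalemxAl.
rewrite scalerA -!scalerDl.
(* With z' the conjugate of z: (z - 1) + (z' - 1) + (z - 1)(z' - 1) = z z' - 1. *)
have -> : (z^* - 1) / inner u u +
     ((z - 1) / inner u u + (z - 1) / inner u u * ((z^* - 1) / inner u u) * inner u u)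
   = (z * z^* - 1) / inner u u by field.
by rewrite zz subrr mul0r scale0r.
Qed.

End Reflections.

(** * Reflection vectors of a multiplicatively closed set of matrices *)

Section ReflectionVectors.
Variables (K : numClosedFieldType) (n : nat) (G : 'M[K]_n -> Prop).
Hypothesis GM : forall A B, G A -> G B -> G (A *m B).

Definition reflection_vector (u : 'cV[K]_n) : Prop :=
  u != 0 /\ forall z, `|z| = 1 -> G (reflection u z).

Lemma reflection_vectorZ a u :
  a != 0 -> reflection_vector u -> reflection_vector (a *: u).
Proof.
move=> a0 [u0 Gu]; split=> [|z z1]; first by rewrite scaler_eq0 negb_or a0.
by rewrite reflectionZ //; apply: Gu.
Qed.

(** The reflection along the image of [v] is a conjugate of one along [v]; the adjoint factor is
    again a reflection along [u], with conjugate parameter, so all three factors lie in [G]. *)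
Lemma reflection_vector_mul u v z : reflection_vector u -> reflection_vector v ->
  `|z| = 1 -> reflection_vector (reflection u z *m v).
Proof.
move=> [u0 Gu] [v0 Gv] z1; have Mu := reflection_unitary u0 z1.
split=> [|z' z'1].
  apply: contra v0 => /eqP Mv; have /mulmx1C MM := unitarymxP Mu.
  by rewrite -[v]mul1mx -MM -mulmxA Mv mulmx0.
rewrite -conj_reflection // reflection_adj.
apply: GM; first by apply: GM; [apply: Gu | apply: Gv].
by apply: Gu; rewrite norm_conjC.
Qed.

Variables (e w : 'cV[K]_n).
Hypotheses (e1 : inner e e = 1) (ew : inner e w = 0) (w0 : w != 0).
Hypothesis Ge : reflection_vector e.

(** The reflection along [e] with parameter [s / t] fixes [w] and turns [t *: e] into [s *: e]. *)
Lemma reflection_vector_phase s t : reflection_vector (t *: e + w) ->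
  `|s| = `|t| -> reflection_vector (s *: e + w).
Proof.
have [-> Gt|t0 Gt st] := eqVneq t 0.
  by rewrite normr0 => /eqP; rewrite normr_eq0 => /eqP ->.
have z1 : `|s / t| = 1 by rewrite normf_div st divff // normr_eq0.
have := reflection_vector_mul Ge Gt z1.
rewrite reflection_mul innerDr innerZr ew e1 addr0 mulr1 divr1 addrAC -scalerDl.
by rewrite (_ : t + _ = s) //; field.
Qed.

(* Up to a scalar, the reflection along [t e + w] sends [e] to [t' e + w] for the displayed [t']. *)
Lemma reflection_vector_turn t z : reflection_vector (t *: e + w) -> t != 0 ->
    `|z| = 1 -> z != 1 ->
  reflection_vector ((inner w w + z * (t * t^*)) / ((z - 1) * t^*) *: e + w).
Proof.
move=> Gt t0 z1 zn1; have := reflection_vector_mul Gt Ge z1.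
have we : inner w e = 0 by rewrite innerC ew conjC0.
rewrite reflection_mul !(innerDl, innerDr, innerZl, innerZr) e1 ew we.
rewrite !(mulr0, addr0, add0r, mulr1).
set N := inner w w; set D := _ + N.
have tc0 : t^* != 0 by rewrite conjC_eq0.
have z10 : z - 1 != 0 by rewrite subr_eq0.
have D0 : D != 0.
  rewrite gt_eqF // ltr_wpDl ?mul_conjC_ge0 //.
    by rewrite mulrC mul_conjC_ge0.
  by rewrite lt_def inner_ge0 inner_eq0 w0.
(* The image of [e] has coefficient (z - 1) conj(t) / D on [w]; scaling by the inverse makes that
   coefficient 1. *)
have a0 : D / ((z - 1) * t^*) != 0 by rewrite mulf_neq0 ?invr_eq0 ?mulf_neq0.
move/(reflection_vectorZ a0).
rewrite [X in reflection_vector X](_ : _ = (N + z * (t * t^*)) / ((z - 1) * t^*) *: e + w) //.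
rewrite scalerDr scalerA [X in _ + X](_ : _ = t *: e + w); last first.
  by rewrite -[RHS]scale1r; congr (_ *: _); field; rewrite D0 z10 tc0.
rewrite addrA -scalerDl; congr (_ *: _ + _).
by rewrite /D; field; rewrite z10 tc0.
Qed.

End ReflectionVectors.

(** * Moving a reflection vector along a complex line *)

Section ReflectionLine.
Variables (R : realType) (n : nat) (G : 'M[R[i]]_n -> Prop).
Hypothesis GM : forall A B, G A -> G B -> G (A *m B).
Local Notation rvec := (reflection_vector G).
Local Open Scope complex_scope.

(* With N = |w|^2 and r = |t|^2, the values |t'|^2 = p reachable from t by a turn are exactly
   those with N + p >= (N + r)^2 / (4 r). *)
Lemma turn_norm (N r p : R) : 0 < N -> 0 < r -> 0 <= p ->
    (N + r) ^+ 2 <= 4 * r * (N + p) ->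
  exists z : R[i], [/\ `|z| = 1, z != 1 &
    forall t : R[i], `|t| ^+ 2 = r%:C ->
      `|(N%:C + z * r%:C) / ((z - 1) * t^*%R)| ^+ 2 = p%:C].
Proof.
move=> N0 r0 p0 hle.
(* With [x] the real part of [z], the squared norm of the quotient is ((N + r)^2 - 2 N r (1 - x)) /
   (2 r (1 - x)). Equating it to [p] gives this [x], and the assumed inequality becomes
   [-1 <= x]. *)
pose x := 1 - (N + r) ^+ 2 / (2 * r * (N + p)).
have Np : 0 < N + p by lra.
have den0 : 0 < 2 * r * (N + p) by rewrite !mulr_gt0.
have x1 : x < 1.
  by rewrite /x gtrBl divr_gt0 // exprn_gt0 // addr_gt0.
have xN1 : -1 <= x.
  by rewrite /x lerBrDr -lerBrDl opprK ler_pdivrMr //; lra.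
have y0 : 0 <= 1 - x ^+ 2 by nra.
pose y := Num.sqrt (1 - x ^+ 2).
have yy : y ^+ 2 = 1 - x ^+ 2 by rewrite sqr_sqrtr.
exists (x +i* y); split.
- by rewrite normc_def /= yy addrC subrK sqrtr1.
- by rewrite eq_complex /= negb_and lt_eqF.
- move=> t tr; rewrite normf_div exprMn exprVn normrM exprMn norm_conjC tr.
  rewrite -!add_Re2_Im2 /= -rmorphM -fmorphV -rmorphM; congr (_%:C).
  rewrite !mulr0 !subr0 !add0r exprMn yy.
  have x10 : 1 - x != 0 by rewrite subr_eq0 gt_eqF.
  have -> : (x - 1) ^+ 2 + (1 - x ^+ 2) = 2 * (1 - x) by ring.
  have -> : (N + x * r) ^+ 2 + (1 - x ^+ 2) * r ^+ 2
          = (N + r) ^+ 2 - 2 * N * r * (1 - x) by ring.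
  have -> : (N + r) ^+ 2 = (1 - x) * (2 * r * (N + p)).
    by rewrite /x subKr divfK // gt_eqF.
  by field; rewrite x10 gt_eqF.
Qed.

Variables (e w : 'cV[R[i]]_n).
Hypotheses (e1 : inner e e = 1) (ew : inner e w = 0) (w0 : w != 0).
Hypothesis Ge : rvec e.

(** Phases along [e] make only |t|^2 matter, so turns act on nonnegative reals: one turn from |t0|^2
    reaches any large enough value, halvings lead down to |w|^2, and a last turn reaches |t|^2. *)
Lemma reflection_vector_line t0 t : rvec (t0 *: e + w) -> t0 != 0 ->
  rvec (t *: e + w).
Proof.
move=> Gt0 t0n.
have [N Nw] : exists N : R, inner w w = N%:C.
  by exists (complex.Re (inner w w)); rewrite RRe_real // ger0_real // inner_ge0.
have N0 : 0 < N by rewrite -ltcR -Nw lt_def inner_ge0 inner_eq0 w0.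
pose sq (t : R[i]) : R := complex.Re t ^+ 2 + complex.Im t ^+ 2.
have sqE s : `|s| ^+ 2 = (sq s)%:C by rewrite -add_Re2_Im2.
have sq0 s : 0 <= sq s by rewrite addr_ge0 // sqr_ge0.
pose Q r := forall s, sq s = r -> rvec (s *: e + w).
have Q_of s : rvec (s *: e + w) -> Q (sq s).
  move=> Gs s' ss; apply: reflection_vector_phase Gs _ => //.
  by apply/eqP; rewrite -(@eqrXn2 _ 2) // !sqE ss.
have step r p : Q r -> 0 < r -> (N + r) ^+ 2 <= 4 * r * (N + p) -> Q p.
  move=> Qr r0 hle s sp; have p0 : 0 <= p by rewrite -sp.
  have [z [z1 zn1 hz]] := turn_norm N0 r0 p0 hle.
  have tr : sq (Num.sqrt r)%:C = r.
    by rewrite /sq /= expr0n /= addr0 sqr_sqrtr // ltW.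
  have tn0 : (Num.sqrt r)%:C != 0 :> R[i].
    by rewrite eq_complex /= eqxx andbT gt_eqF // sqrtr_gt0.
  have := reflection_vector_turn GM e1 ew w0 Ge (Qr _ tr) tn0 z1 zn1.
  rewrite Nw -normCK sqE tr => /Q_of /(_ s); apply.
  have := hz _ (etrans (sqE _) (congr1 _ tr)).
  by rewrite sqE sp => /complexI.
have r0 : 0 < sq t0 by rewrite -ltcR -sqE exprn_gt0 // normr_gt0.
(* A turn can replace |t|^2 = 2 p by p as long as p >= N; once |t|^2 = N, a turn reaches
   any value. *)
have halving k : forall p, N <= p -> (sq t0 + N ^+ 2 / sq t0) <= 2 ^+ k * p -> Q p.
  elim: k => [|k IHk] p Np hp.
    apply: (step _ _ (Q_of _ Gt0) r0).
    move: hp; rewrite expr0 mul1r -(ler_pM2r r0) mulrDl divfK ?gt_eqF //.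
    by nra.
  apply: (step (2 * p)); [|lra|nra].
  by apply: IHk; [lra|rewrite mulrA -exprSr].
have QN : Q N.
  pose q := (sq t0 + N ^+ 2 / sq t0) / N.
  (* This many halvings suffice, since q < [Num.bound q] < 2 ^ [Num.bound q]. *)
  apply: (halving (Num.bound q)) => //.
  rewrite -ler_pdivrMr //; apply: ltW.
  apply: lt_trans (archi_boundP _) _.
    by rewrite divr_ge0 ?addr_ge0 ?divr_ge0 ?sqr_ge0 // ltW.
  by rewrite -natrX ltr_nat ltn_expl.
have Nt := mulr_ge0 (ltW N0) (sq0 t).
by apply: (step N (sq t)) => //; lra.
Qed.

End ReflectionLine.

(** * Changing coordinates one at a time *)

Section AllVectors.
Variables (R : realType) (n : nat) (G : 'M[R[i]]_n -> Prop).
Hypothesis GM : forall A B, G A -> G B -> G (A *m B).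
Local Notation rvec := (reflection_vector G).

Lemma reflection_vector_coord (u x : 'cV[R[i]]_n) k :
    rvec u -> rvec (delta_mx k 0) -> u k 0 != 0 -> x != 0 ->
    (forall i, i != k -> x i 0 = u i 0) ->
  rvec x.
Proof.
move=> Gu Ge uk x0 xu; set e := delta_mx k 0 in Ge.
pose w := u - u k 0 *: e.
have uE : u = u k 0 *: e + w by rewrite addrC subrK.
have xE : x = x k 0 *: e + w.
  apply/colP => i; rewrite !mxE eqxx andbT.
  case: eqVneq => [->|ik]; first by rewrite !mulr1 subrr addr0.
  by rewrite !mulr0 subr0 add0r xu.
(* For [w = 0] there is no line to move along, but then [x] is a nonzero multiple of the basis
   vector. *)
have [w0|w0] := eqVneq w 0.
  have xk : x k 0 != 0.
    by apply: contra_neq x0 => xk; rewrite xE xk w0 scale0r addr0.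
  by rewrite xE w0 addr0; apply: reflection_vectorZ.
rewrite xE; apply: (reflection_vector_line GM _ _ w0 Ge _ _ uk).
- by rewrite inner_delta mxE !eqxx.
- by rewrite inner_delta !mxE !eqxx mulr1 subrr.
- by rewrite -uE.
Qed.

(** Coordinates are replaced from left to right; the next one to change is still that of [f], hence
    nonzero as a coordinate change requires. The alternative [x k 0 = f k 0] allows a use before
    every basis vector is available. *)
Lemma reflection_vector_replace (f x : 'cV[R[i]]_n) :
    rvec f -> (forall k, f k 0 != 0) -> x != 0 ->
    (forall k, rvec (delta_mx k 0) \/ x k 0 = f k 0) ->
  rvec x.
Proof.
move=> Gf f0 x0 hx.
pose h m : 'cV[R[i]]_n := \col_i if (i < m)%N then x i 0 else f i 0.
suff Gh m : (m <= n)%N -> rvec (h m).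
  suff <- : h n = x by apply: Gh.
  by apply/colP => i; rewrite mxE ltn_ord.
elim: m => [|m IHm] mn.
  by suff -> : h 0%N = f by []; apply/colP => i; rewrite mxE.
have {}IHm := IHm (ltnW mn); pose k := Ordinal mn.
have hS i : i != k -> h m.+1 i 0 = h m i 0.
  by rewrite !mxE ltnS (leq_eqVlt i) -[X in X || _]/(i == k) => /negPf ->.
(* Before the last stage, coordinate [m.+1] is still a nonzero entry of [f]; at the last stage the
   vector is [x]. *)
have h0 : h m.+1 != 0.
  have [mn'|] := ltnP m.+1 n.
    apply: contraNneq (f0 (Ordinal mn')) => /colP/(_ (Ordinal mn')).
    by rewrite !mxE ltnn => ->.
  move=> nm; suff -> : h m.+1 = x by [].
  by apply/colP => i; rewrite mxE (leq_trans (ltn_ord i) nm).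
have hk : h m k 0 = f k 0 by rewrite mxE ltnn.
have [Gk|xf] := hx k.
  by apply: (reflection_vector_coord IHm Gk) => //; rewrite hk.
suff -> : h m.+1 = h m by [].
apply/colP => i; have [->|/hS //] := eqVneq i k.
by rewrite hk mxE ltnSn.
Qed.

End AllVectors.

(** Diagonalize [V] in an orthonormal basis and insert the eigenvalues, all of modulus one, one by
    one: each contributes a reflection along an eigenvector, a column of [P ^t*]. *)
Lemma unitary_reflection_closed (K : numClosedFieldType) n (G : 'M[K]_n -> Prop) V :
    G 1%:M -> (forall A B, G A -> G B -> G (A *m B)) ->
    (forall u, u != 0 -> reflection_vector G u) -> V \is unitarymx ->
  G V.
Proof.
move=> G1 GM GS Vu; have VV := unitarymxP Vu.
have Vn : V \is normalmx by apply/normalmxP; rewrite VV (mulmx1C VV).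
have Pu := spectral_unitarymx V.
have := orthomx_spectralP Vn; rewrite invmx_unitary //.
set P := spectralmx V in Pu *; set c := spectral_diag V => VE.
have PP := unitarymxP Pu.
have cE : diag_mx c = P *m V *m P ^t*.
  by rewrite [in RHS]VE !mulmxA PP mul1mx -mulmxA PP mulmx1.
have c1 j : `|c 0 j| = 1.
  have : diag_mx c \is unitarymx.
    by rewrite cE !mul_unitarymx // trmxC_unitary.
  move/unitarymxP/matrixP/(_ j j); rewrite tr_diag_mx map_diag_mx mulmx_diag !mxE.
  by rewrite eqxx !mulr1n -normCK => /eqP; rewrite sqrp_eq1 // => /eqP.
pose h m : 'rV[K]_n := \row_j if (j < m)%N then c 0 j else 1.
suff Gh m : (m <= n)%N -> G (P ^t* *m diag_mx (h m) *m P).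
  rewrite VE; have -> : c = h n by apply/rowP => j; rewrite mxE ltn_ord.
  exact: Gh.
elim: m => [|m IHm] mn.
  have -> : h 0%N = const_mx 1 by apply/rowP => j; rewrite !mxE.
  by rewrite diag_const_mx mulmx1 (mulmx1C PP).
pose k := Ordinal mn; pose d : 'rV[K]_n := \row_j if j == k then c 0 k else 1.
have -> : P ^t* *m diag_mx (h m.+1) *m P =
    (P ^t* *m diag_mx (h m) *m P) *m (P ^t* *m diag_mx d *m P).
  have -> : diag_mx (h m.+1) = diag_mx (h m) *m diag_mx d.
    rewrite mulmx_diag; congr diag_mx; apply/rowP => j; rewrite !mxE ltnS leq_eqVlt.
    rewrite -[X in X || _]/(j == k); case: eqVneq => [->|_]; last by rewrite mulr1.
    by rewrite ltnn mul1r.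
  by rewrite !mulmxA -(mulmxA _ P) PP mulmx1.
apply: GM; first exact/IHm/ltnW.
have Pcu : P ^t* \is unitarymx by rewrite trmxC_unitary.
rewrite -{2}[P]trmxCK conj_diag //; apply: (GS _ _).2 => //.
apply/eqP => Pk0; have := congr1 (fun u => (P *m u) k 0) Pk0.
by rewrite colE mulmxA PP mul1mx mulmx0 !mxE !eqxx => /eqP; rewrite oner_eq0.
Qed.


(** * The Fourier matrix *)

Lemma cis_exp (R : realType) (a : R) k :
  Complex (cos a) (sin a) ^+ k = Complex (cos (a *+ k)) (sin (a *+ k)).
Proof.
elim: k => [|k IHk]; first by rewrite !mulr0n cos0 sin0.
rewrite exprS IHk mulrS cosD sinD; apply/eqP.
by rewrite eq_complex /= eqxx /= addrC.
Qed.

(** The order divides the prime [d], and order 1 is excluded because sin(2 pi / d) > 0 for d > 2. *)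
Lemma cis_prim (R : realType) d : prime d -> odd d ->
  d.-primitive_root (Complex (cos (2 * pi / d%:R)) (sin (2 * pi / d%:R)) : R[i]).
Proof.
move=> pd od; have d_gt2 : (2 < d)%N by apply: odd_prime_gt2.
have d0 : 0 < d%:R :> R by rewrite ltr0n prime_gt0.
set a : R := 2 * pi / d%:R; set z := Complex _ _.
have zd : z ^+ d = 1.
  by rewrite cis_exp -mulr_natr divfK ?gt_eqF // mulr_natl cos2pi sin2pi.
have [m pm /((primeP pd).2 m) /orP[] /eqP mE] :=
  prim_order_exists (prime_gt0 pd) zd; last by rewrite -mE.
have := prim_expr_order pm; rewrite mE expr1 => -[_ /eqP].
rewrite gt_eqF // sin_gt0_pi // divr_gt0 ?mulr_gt0 ?pi_gt0 //=.
by rewrite ltr_pdivrMr // mulrC ltr_pM2l ?pi_gt0 // ltr_nat.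
Qed.

Lemma sum_expr_unity (K : fieldType) d (q : K) :
  q ^+ d = 1 -> \sum_(j < d) q ^+ j = if q == 1 then d%:R else 0.
Proof.
move=> qd; case: eqVneq => [->|q1].
  by under eq_bigr do rewrite expr1n; rewrite sumr_const card_ord.
apply/eqP; have := subrX1 q d; rewrite qd subrr => /esym/eqP.
by rewrite mulf_eq0 subr_eq0 (negPf q1).
Qed.

Section Fourier.
Variables (K : numClosedFieldType) (d : nat) (w s : K).
Hypotheses (w_prim : d.-primitive_root w) (s_gt0 : 0 < s) (ss : s ^+ 2 = d%:R).

Definition fourier : 'M[K]_d := \matrix_(m, j) (w ^+ (j * m) / s).

Let d_gt0 : (0 < d)%N := prim_order_gt0 w_prim.
Let wd : w ^+ d = 1 := prim_expr_order w_prim.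
Let ss0 : s * s != 0 := lt0r_neq0 (mulr_gt0 s_gt0 s_gt0).
Let w_norm : `|w| = 1.
Proof. by apply/eqP; rewrite -(@pexpr_eq1 _ _ d) // -normrX wd normr1. Qed.

(** Entry (m, k) of the product with the adjoint is a geometric sum with ratio w^m conj(w^k), a
    [d]-th root of unity equal to 1 only for m = k. *)
Lemma fourier_unitary : fourier \is unitarymx.
Proof.
apply/unitarymxP/matrixP => m k; rewrite !mxE.
have wc a : w ^+ a * (w ^+ a)^* = 1 by rewrite -normCK normrX w_norm !expr1n.
pose q := w ^+ m * (w ^+ k)^*.
have qd : q ^+ d = 1.
  rewrite exprMn -(rmorphXn Num.conj) -!exprM ![(_ * d)%N]mulnC !exprM wd !expr1n.
  by rewrite rmorph1 mulr1.
transitivity (\sum_(j < d) q ^+ j / (s * s)).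
  apply: eq_bigr => j _; rewrite !mxE rmorphM /= fmorphV /= (CrealP (gtr0_real s_gt0)).
  rewrite mulrACA invfM; congr (_ * _).
  by rewrite mulnC [(j * k)%N]mulnC !exprM exprMn rmorphXn.
rewrite -mulr_suml sum_expr_unity // -ss.
have -> : (q == 1) = (m == k).
  rewrite -(inj_eq (mulIf (_ : w ^+ k != 0))); last first.
    by rewrite expf_neq0 // -normr_eq0 w_norm oner_eq0.
  rewrite mul1r /q -mulrA [_^* * _]mulrC wc mulr1.
  by rewrite (eq_prim_root_expr w_prim) !modn_small // ltn_ord.
by case: eqVneq => _; rewrite ?mul0r // -expr2 divff // expr2.
Qed.

(* F^2 is the permutation matrix of j |-> -j, but its being real already gives F^4 = 1. *)
Lemma fourier_sqr_real : map_mx Num.conj (fourier *m fourier) = fourier *m fourier.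
Proof.
apply/matrixP => m k; rewrite !mxE; set S := \sum_j _.
suff -> : S = (w ^+ (m + k) == 1)%:R by rewrite conjC_nat.
transitivity (\sum_(j < d) (w ^+ (m + k)) ^+ j / (s * s)).
  apply: eq_bigr => j _; rewrite !mxE mulrACA invfM; congr (_ * _).
  by rewrite -exprD -exprM mulnDl [(k * j)%N]mulnC [(j * m)%N]mulnC.
rewrite -mulr_suml sum_expr_unity; last by rewrite -exprM mulnC exprM wd expr1n.
by case: eqP => _; rewrite ?mul0r // -ss -expr2 divff // expr2.
Qed.

Lemma fourier_adj : fourier ^t* = fourier *m (fourier *m fourier).
Proof.
have Ft : fourier ^t* = map_mx Num.conj fourier.
  by apply/matrixP => i j; rewrite !mxE mulnC.
have FF := unitarymxP fourier_unitary; have FV := mulmx1C FF.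
(* As [fourier] is symmetric, its adjoint is its conjugate; [fourier] squared being real, it equals
   the square of the adjoint, which cancels the other two factors. *)
have F4 : fourier *m (fourier *m (fourier *m fourier)) = 1%:M.
  rewrite mulmxA -[X in _ *m X]fourier_sqr_real map_mxM -Ft.
  by rewrite -mulmxA (mulmxA fourier (_ ^t*)) FF mul1mx.
by rewrite -[LHS]mulmx1 -F4 mulmxA FV mul1mx.
Qed.

End Fourier.

(** * Products of the gates U(c) *)

Lemma gate_product_cat d (s t : seq 'rV[Defs.C]_d) :
  gate_product (s ++ t) = gate_product s *m gate_product t.
Proof.
by elim: s => [|c s IHs] /=; rewrite ?mul1mx // IHs mulmxA.
Qed.

Definition generated d (M : 'M[Rdefinitions.R[i]]_d) : Prop :=
  exists s : seq 'rV[Defs.C]_d,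
    (forall c, List.In c s -> admissible c) /\ M = gate_product s.

Lemma generated1 d : generated (1%:M : 'M[Rdefinitions.R[i]]_d).
Proof. by exists [::]. Qed.

Lemma generatedM d (A B : 'M[Rdefinitions.R[i]]_d) :
  generated A -> generated B -> generated (A *m B).
Proof.
move=> [s [hs ->]] [t [ht ->]]; exists (s ++ t); rewrite gate_product_cat.
by split=> // c hc; case: (List.in_app_or _ _ _ hc) => [/hs|/ht].
Qed.

Section Generation.
Variables (d : nat) (pd : prime d) (od : odd d).
Local Notation R := Rdefinitions.R.
Local Notation F := (QFT d : 'M[R[i]]_d).
Local Notation rvec := (reflection_vector (@generated d)).
Local Open Scope complex_scope.

Let sqrtd_gt0 : (0 : R[i]) < (Num.sqrt (d%:R : R))%:C.
Proof. by rewrite ltcR sqrtr_gt0 ltr0n prime_gt0. Qed.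

Let sqrtd_sqr : (Num.sqrt (d%:R : R))%:C ^+ 2 = d%:R :> R[i].
Proof. by rewrite -rmorphXn sqr_sqrtr ?ler0n // rmorph_nat. Qed.

Let F_unitary : F \is unitarymx.
Proof. exact: (fourier_unitary (cis_prim R pd od) sqrtd_gt0 sqrtd_sqr). Qed.

Let F_adj : F ^t* = F *m (F *m F).
Proof. exact: (fourier_adj (cis_prim R pd od) sqrtd_gt0 sqrtd_sqr). Qed.

Lemma generated_gate (c : 'rV[R[i]]_d) : admissible c -> generated (F *m diag_mx c).
Proof.
move=> hc; exists [:: c]; split=> [c' [<-|[]] //|].
by rewrite /= mulmx1.
Qed.

Lemma generated_QFT : generated F.
Proof.
rewrite -[F]mulmx1 -diag_const_mx; apply: generated_gate.
by split=> j *; rewrite mxE ?normr1.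
Qed.

Lemma generated_QFT_adj : generated (F ^t*).
Proof. by rewrite F_adj; do !apply: generatedM; apply: generated_QFT. Qed.

Lemma generated_diag (k : 'I_d) (z : R[i]) : k != 0%N :> nat -> `|z| = 1 ->
  generated (diag_mx (\row_j if j == k then z else 1)).
Proof.
(* Write the diagonal matrix as [F ^t*] times a gate; [k] being nonzero keeps entry 0 equal to 1. *)
move=> k0 z1; rewrite -[diag_mx _]mul1mx -(mulmx1C (unitarymxP F_unitary)) -mulmxA.
apply: generatedM generated_QFT_adj (generated_gate _).
split=> j; rewrite mxE; first by case: eqP => _; rewrite ?normr1.
by move=> j0; case: eqP => // jk; rewrite -jk j0 in k0.
Qed.

Lemma generated_delta (k : 'I_d) : k != 0%N :> nat -> rvec (delta_mx k 0).
Proof.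
move=> k0; split=> [|z z1]; last by rewrite reflection_delta; apply: generated_diag.
by apply/eqP => /colP/(_ k)/eqP; rewrite !mxE !eqxx oner_eq0.
Qed.

Lemma generated_reflection_vector u : u != 0 -> rvec u.
Proof.
pose k0 := Ordinal (prime_gt0 pd); pose k1 := Ordinal (prime_gt1 pd).
pose f : 'cV[R[i]]_d := col k1 F.
have w0 : (omega d : R[i]) != 0.
  apply: contra_neq (oner_neq0 R[i]) => w0.
  by rewrite -(prim_expr_order (cis_prim R pd od)) -/(omega d) w0 expr0n gtn_eqF ?prime_gt0.
have f0 k : f k 0 != 0.
  by rewrite !mxE mulf_neq0 ?expf_neq0 ?invr_eq0 ?(gt_eqF sqrtd_gt0).
have Gf : rvec f.
  split=> [|z z1]; first by apply/eqP => /colP/(_ k0)/eqP; rewrite [X in _ == X]mxE (negPf (f0 k0)).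
  (* Along column 1 of [F] the reflection is a diagonal matrix conjugated by [F]; only entry 1 of
     the diagonal varies, so the parameters are admissible. *)
  rewrite -conj_diag //; apply: generatedM generated_QFT_adj.
  by apply: generatedM generated_QFT _; apply: generated_diag.
have Gdelta k : rvec (delta_mx k 0).
  have [k_0|] := eqVneq (k : nat) 0%N; last exact: generated_delta.
  (* Here [k] is index 0: [x] keeps coordinate 0 of [f] and zeroes the others, along basis vectors
     already obtained. *)
  pose x : 'cV[R[i]]_d := f k 0 *: delta_mx k 0.
  have Gx : rvec x.
    apply: (reflection_vector_replace (@generatedM d) Gf f0).
      by rewrite scaler_eq0 negb_or f0; apply/eqP => /colP/(_ k)/eqP; rewrite !mxE !eqxx oner_eq0.
    move=> j; have [j_0|] := eqVneq (j : nat) 0%N; last by left; apply: generated_delta.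
    right; have -> : j = k by apply: val_inj; rewrite /= j_0 k_0.
    by rewrite [LHS]mxE [X in _ * X]mxE !eqxx mulr1.
  have -> : delta_mx k 0 = (f k 0)^-1 *: x.
    by rewrite scalerA mulVf ?scale1r.
  by apply: reflection_vectorZ; rewrite ?invr_eq0.
move=> u0; apply: (reflection_vector_replace (@generatedM d) Gf f0 u0) => k.
left; exact: Gdelta.
Qed.

End Generation.

Theorem theorem3 (d : nat) (hd : prime d) (hodd : odd d) (V : 'M[C]_d) :
  unitary_mx V ->
  exists s : seq 'rV[C]_d, (forall c, List.In c s -> admissible c) /\ V = gate_product s.
Proof.
move=> Vu; apply: (unitary_reflection_closed (G := @generated d) (generated1 d)
  (@generatedM d) (generated_reflection_vector hd hodd)).
by apply/unitarymxP; rewrite -map_trmx; apply: Vu.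
Qed.
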